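(* Let $d\ge 2$ and let $r$ be an integer with $r\le d/2\le r+1$. For $(i_1,\dots,i_d)\in\{0,1\}^d$ write $i_\bullet=\sum_{j=1}^d i_j$. Let $(I_1^-,\dots,I_d^-)$ have probability mass function $$\Pr(I_1^-=i_1,\dots,I_d^-=i_d)=\begin{cases}(r+1-d/2)\binom{d}{r}^{-1}, & i_\bullet=r\\ (d/2-r)\binom{d}{r+1}^{-1}, & i_\bullet=r+1\\ 0,&\text{otherwise},\end{cases}$$ and let $(I_1^+,\dots,I_d^+)$ have probability mass function $$\Pr(I_1^+=i_1,\dots,I_d^+=i_d)=\begin{cases}1/2, & i_\bullet\in\{0,d\}\\ 0,&\text{otherwise}.\end{cases}$$ Then for all vectors $(I_1,\dots,I_d)$ of exchangeable symmetric Bernoulli random variables, $$(I_1^-,\dots,I_d^-)\preceq_{sm}(I_1,\dots,I_d)\preceq_{sm}(I_1^+,\dots,I_d^+).$$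
   Context: A vector of symmetric Bernoulli random variables is a random vector $(I_1,\dots,I_d)$ in $\{0,1\}^d$ with $\Pr(I_j=1)=1/2$ for all $j$; it is exchangeable if its joint distribution is invariant under permutations of the components. Supermodular order: $(V_1,\dots,V_d)\preceq_{sm}(V_1',\dots,V_d')$ if $E\{\phi(V_1,\dots,V_d)\}\le E\{\phi(V_1',\dots,V_d')\}$ for all supermodular functions $\phi:\mathbb{R}^d\to\mathbb{R}$ such that the expectations exist. Here $\phi$ is supermodular if $$\phi(x_1,\dots,x_i+\varepsilon,\dots,x_j+\delta,\dots,x_d)-\phi(x_1,\dots,x_i+\varepsilon,\dots,x_j,\dots,x_d)\ge \phi(x_1,\dots,x_i,\dots,x_j+\delta,\dots,x_d)-\phi(x_1,\dots,x_i,\dots,x_j,\dots,x_d)$$ for all $(x_1,\dots,x_d)\in\mathbb{R}^d$, $1\le i<j\le d$ and all $\varepsilon,\delta>0$. *)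

(* Defs.v *)
From HB Require Import structures.
From mathcomp Require Import all_boot all_order all_algebra.
From mathcomp Require Import all_fingroup.
From mathcomp Require Import all_classical all_reals all_analysis.
Set Implicit Arguments.
Unset Strict Implicit.
Unset Printing Implicit Defensive.
Import Order.TTheory GRing.Theory Num.Theory.
Local Open Scope classical_set_scope.
Local Open Scope ring_scope.

(* Vectors of R^d are [d.-tuple R], which carries the product sigma-algebra,
   so a random vector is an [{RV P >-> d.-tuple R}]. *)

Definition shift_coord (R : realType) (d : nat) (x : d.-tuple R) (i : 'I_d)
    (e : R) : d.-tuple R :=
  [tuple if k == i then tnth x k + e else tnth x k | k < d].

Definition supermodular (R : realType) (d : nat) (phi : d.-tuple R -> R) :=
  forall (x : d.-tuple R) (i j : 'I_d) (eps delta : R),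
    (i < j)%N -> 0 < eps -> 0 < delta ->
    phi (shift_coord (shift_coord x i eps) j delta) - phi (shift_coord x i eps)
      >= phi (shift_coord x j delta) - phi x.

(* The two vectors may live on different probability spaces; "the expectations
   exist" is integrability, which includes measurability of [phi \o V]. *)
Definition sm_le (R : realType) (d : nat)
    (disp : measure_display) (T : measurableType disp) (P : probability T R)
    (disp' : measure_display) (T' : measurableType disp')
    (P' : probability T' R)
    (V : {RV P >-> d.-tuple R}) (V' : {RV P' >-> d.-tuple R}) :=
  forall phi : d.-tuple R -> R, supermodular phi ->
    P.-integrable [set: T] (EFin \o (phi \o V)) ->
    P'.-integrable [set: T'] (EFin \o (phi \o V')) ->
    ('E_P[phi \o V] <= 'E_P'[phi \o V'])%E.

(* {0,1}-valuedness is only required almost surely. *)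
Definition symmetric_bernoulli (R : realType) (d : nat)
    (disp : measure_display) (T : measurableType disp) (P : probability T R)
    (V : {RV P >-> d.-tuple R}) :=
  {ae P, forall t, forall j : 'I_d, tnth (V t) j = 0 \/ tnth (V t) j = 1} /\
  forall j : 'I_d, P [set t | tnth (V t) j = 1] = (1 / 2)%:E.

Definition exchangeable (R : realType) (d : nat)
    (disp : measure_display) (T : measurableType disp) (P : probability T R)
    (V : {RV P >-> d.-tuple R}) :=
  forall (s : 'S_d) (B : set (d.-tuple R)), measurable B ->
    pushforward P (fun t => [tuple tnth (V t) (s j) | j < d]) B =
    distribution P V B.

(* Points of {0,1}^d are boolean tuples, embedded in R^d coordinatewise. *)
Definition real_of_bits (R : realType) (d : nat) (i : d.-tuple bool) :
    d.-tuple R :=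
  [tuple (tnth i j)%:R | j < d].

Definition bitsum (d : nat) (i : d.-tuple bool) : nat :=
  (\sum_(j < d) tnth i j)%N.

Definition has_pmf (R : realType) (d : nat)
    (disp : measure_display) (T : measurableType disp) (P : probability T R)
    (V : {RV P >-> d.-tuple R}) (p : d.-tuple bool -> R) :=
  forall i : d.-tuple bool, P [set t | V t = real_of_bits R i] = (p i)%:E.

Definition pmf_minus (R : realType) (d r : nat) (i : d.-tuple bool) : R :=
  if bitsum i == r then (r%:R + 1 - d%:R / 2) * ('C(d, r)%:R)^-1
  else if bitsum i == r.+1 then (d%:R / 2 - r%:R) * ('C(d, r.+1)%:R)^-1
  else 0.

Definition pmf_plus (R : realType) (d : nat) (i : d.-tuple bool) : R :=
  if (bitsum i == 0%N) || (bitsum i == d) then 1 / 2 else 0.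

(* Main.v *)
(** For an exchangeable law on {0,1}^d, E phi(V) is unchanged when phi is
    symmetrized over S_d, after which phi becomes a function G of the number k
    of ones.  Supermodularity of phi makes G convex, and E(sum_j V_j) = d/2.
    The lower bound is the supporting line of G through r and r+1, both of which
    carry the mass of I^-; the upper bound is the chord of G on [0, d], whose
    endpoints carry the mass of I^+. *)
Require Import Defs.
From HB Require Import structures.
From mathcomp Require Import all_boot all_order all_algebra.
From mathcomp Require Import all_fingroup.
From mathcomp Require Import zify ring lra.
From mathcomp Require Import all_classical all_reals all_analysis measurable_realfun.
Set Implicit Arguments.
Unset Strict Implicit.
Unset Printing Implicit Defensive.
Import Order.TTheory GRing.Theory Num.Theory.
Local Open Scope classical_set_scope.
Local Open Scope ring_scope.


(** * Bit vectors, coordinate permutations and levels of {0,1}^d *)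

Lemma perm_eq_bits (s t : seq bool) :
  size s = size t -> count id s = count id t -> perm_eq s t.
Proof.
move=> sz ct; apply/seq.permP => a.
(* A predicate on [bool] is given by its two values, so any count is determined by the numbers of
   [true] and [false] entries. *)
have countE (u : seq bool) :
    count a u = (a true * count id u + a false * (size u - count id u))%N.
  elim: u => [|b u /= ->]; first by rewrite !muln0.
  have cu := count_size id u.
  by case: b => /=; rewrite ?add1n ?add0n ?subSS ?subSn// mulnS; lia.
by rewrite !countE ct sz.
Qed.

Definition permute_tuple (T : Type) (d : nat) (s : 'S_d) (x : d.-tuple T) :
  d.-tuple T := [tuple tnth x (s j) | j < d].

Lemma permute_tupleM (T : Type) (d : nat) (s u : 'S_d) (x : d.-tuple T) :
  permute_tuple s (permute_tuple u x) = permute_tuple (s * u)%g x.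
Proof. by apply: eq_from_tnth => j; rewrite !tnth_mktuple permM. Qed.

Lemma permute_tuple1 (T : Type) (d : nat) (x : d.-tuple T) :
  permute_tuple 1%g x = x.
Proof. by apply: eq_from_tnth => j; rewrite tnth_mktuple perm1. Qed.

Lemma permute_tuple_inj (T : Type) (d : nat) (s : 'S_d) :
  injective (@permute_tuple T d s).
Proof.
apply: (can_inj (g := permute_tuple s^-1%g)) => x.
by rewrite permute_tupleM mulVg permute_tuple1.
Qed.

(** For [k <= d], the chosen representative of the S_d-orbit of vectors with [k] ones. *)
Definition first_ones (d k : nat) : d.-tuple bool := [tuple (j < k)%N | j < d].

Lemma bitsum_count (d : nat) (x : d.-tuple bool) : bitsum x = count id x.
Proof.
rewrite /bitsum -sum1_count big_tuple [RHS]big_mkcond.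
by apply: eq_bigr => j _; case: (tnth x j).
Qed.

Lemma bitsum_le (d : nat) (x : d.-tuple bool) : (bitsum x <= d)%N.
Proof. by rewrite bitsum_count (leq_trans (count_size _ _))// size_tuple. Qed.

Lemma bitsum_permute (d : nat) (s : 'S_d) (x : d.-tuple bool) :
  bitsum (permute_tuple s x) = bitsum x.
Proof.
rewrite [RHS](reindex_inj (@perm_inj _ s)); apply: eq_bigr => j _.
by rewrite tnth_mktuple.
Qed.

Lemma bitsum_first_ones (d k : nat) :
  (k <= d)%N -> bitsum (first_ones d k) = k.
Proof.
move=> kd; under [LHS]eq_bigr do rewrite tnth_mktuple.
rewrite -[RHS](card_ord k) -sum1_card (big_ord_widen d (fun=> 1%N) kd) [RHS]big_mkcond.
by apply: eq_bigr => j _; case: ltnP.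
Qed.

Lemma permute_first_ones (d : nat) (x : d.-tuple bool) :
  exists s : 'S_d, x = permute_tuple s (first_ones d (bitsum x)).
Proof.
have /tuple_permP[s xE] : perm_eq x (first_ones d (bitsum x)).
  apply: perm_eq_bits; first by rewrite !size_tuple.
  by rewrite -!bitsum_count bitsum_first_ones// bitsum_le.
by exists s; apply: val_inj.
Qed.

(** Taking supports is a bijection onto the [k]-element subsets of ['I_d]. *)
Lemma card_bitsum (d k : nat) :
  #|[pred x : d.-tuple bool | bitsum x == k]| = 'C(d, k).
Proof.
rewrite -[in RHS](card_ord d) -card_draws.
pose supp (x : d.-tuple bool) := finset (tnth x).
have supp_inj : injective supp.
  move=> x y xy; apply: eq_from_tnth => j.
  by have := congr1 (fun B : {set _} => j \in B) xy; rewrite !inE.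
have card_supp x : #|supp x| = bitsum x.
  rewrite -sum1_card big_mkcond; apply: eq_bigr => j _.
  by rewrite inE; case: (tnth x j).
rewrite -(card_imset _ supp_inj); apply: eq_card => A; rewrite inE.
apply/imsetP/eqP => [[x + ->]|Ak]; first by rewrite inE card_supp => /eqP.
have suppA : supp [tuple j \in A | j < d] = A.
  by apply/finset.setP => j; rewrite inE tnth_mktuple.
by exists [tuple j \in A | j < d] => //; rewrite inE -card_supp suppA Ak.
Qed.

Lemma sum_bitsum_eq (R : realType) (d k : nat) (f : nat -> R) :
  \sum_(x : d.-tuple bool | bitsum x == k) f (bitsum x) = f k *+ 'C(d, k).
Proof.
rewrite (eq_bigr (fun=> f k)) => [|x /eqP -> //].
by rewrite sumr_const -card_bitsum; congr (_ *+ _); apply: eq_card => x; rewrite inE.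
Qed.

(** * Supermodularity on {0,1}^d and symmetrization *)

Lemma supermodular_bits (R : realType) (d : nat) (phi : d.-tuple R -> R)
    (i j : 'I_d) (x y z w : d.-tuple bool) :
  supermodular phi -> i != j -> tnth x i = false -> tnth x j = false ->
  (forall m, tnth y m = (m == i) || tnth x m) ->
  (forall m, tnth z m = (m == j) || tnth x m) ->
  (forall m, tnth w m = (m == i) || (m == j) || tnth x m) ->
  phi (real_of_bits R z) - phi (real_of_bits R x)
    <= phi (real_of_bits R w) - phi (real_of_bits R y).
Proof.
move=> phi_sm.
(* The inequality is invariant under exchanging [(i, y)] with [(j, z)], so the order required by
   [supermodular] costs nothing; unit increments then suffice. *)
wlog ij : i j y z / (i < j)%N.
  move=> base ij xi xj yE zE wE; have := ij; rewrite neq_ltn => /orP[lij|lji].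
    exact: (base i j).
  have := base j i z y lji; rewrite eq_sym => /(_ ij xj xi zE yE).
  by move=> /(_ (fun m => etrans (wE m) (congr1 (orb^~ _) (orbC _ _)))); lra.
move=> neq xi xj yE zE wE.
have yS : real_of_bits R y = shift_coord (real_of_bits R x) i 1.
  apply: eq_from_tnth => m; rewrite !tnth_mktuple yE.
  by have [->|] := eqVneq m i; rewrite //= xi add0r.
have zS : real_of_bits R z = shift_coord (real_of_bits R x) j 1.
  apply: eq_from_tnth => m; rewrite !tnth_mktuple zE.
  by have [->|] := eqVneq m j; rewrite //= xj add0r.
have wS : real_of_bits R w = shift_coord (real_of_bits R y) j 1.
  apply: eq_from_tnth => m; rewrite !tnth_mktuple wE yE.
  have [->|mj] := eqVneq m j; last by rewrite orbF.
  by rewrite eq_sym (negbTE neq) /= xj add0r.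
by rewrite zS wS yS; apply: phi_sm.
Qed.

(* [d!] times the average of [phi] over the points of {0,1}^d with [k] ones,
   for [k <= d]. *)
Definition symsum (R : realType) (d : nat) (phi : d.-tuple R -> R) (k : nat) : R :=
  \sum_(s : 'S_d) phi (real_of_bits R (permute_tuple s (first_ones d k))).

(** For each [s], supermodularity is applied to the square based at the permuted [first_ones d k],
    with directions the preimages under [s] of the positions [k] and [k.+1]. Both middle vertices
    have [k.+1] ones, so after summation over [s] each contributes [symsum phi k.+1]. *)
Lemma symsum_convex (R : realType) (d : nat) (phi : d.-tuple R -> R) (k : nat) :
  supermodular phi -> (k.+2 <= d)%N ->
  symsum phi k.+1 - symsum phi k <= symsum phi k.+2 - symsum phi k.+1.
Proof.
move=> phi_sm kd.
pose a := Ordinal (ltnW kd); pose b := Ordinal kd.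
have ab : a != b by rewrite -val_eqE /= ltn_eqF.
(* Composing with the transposition turns x + e_a into x + e_b. *)
rewrite {1}/symsum (reindex_inj (mulIg (tperm a b))) /= -!sumrB.
apply: ler_sum => s _.
apply: (@supermodular_bits _ _ _ ((s^-1)%g a) ((s^-1)%g b)) => //.
- by rewrite (inj_eq perm_inj).
- by rewrite tnth_mktuple permKV tnth_mktuple ltnn.
- by rewrite tnth_mktuple permKV tnth_mktuple /= ltnNge leqnSn.
- move=> m; rewrite !tnth_mktuple -(inj_eq (@perm_inj _ s)) permKV -val_eqE /=.
  by rewrite ltnS leq_eqVlt.
- move=> m; rewrite !tnth_mktuple -(inj_eq (@perm_inj _ s)) permKV permM.
  case: tpermP => [->|->|/eqP + /eqP].
  + by rewrite (negbTE ab) /= !ltnn.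
  + by rewrite eqxx /= ltnSn.
  rewrite -!val_eqE /= => ma mb.
  by rewrite ltnS leq_eqVlt (negbTE ma) (negbTE mb).
- move=> m; rewrite !tnth_mktuple -(inj_eq (@perm_inj _ s) m ((s^-1)%g a)).
  rewrite -(inj_eq (@perm_inj _ s) m ((s^-1)%g b)) !permKV -!val_eqE /=.
  by rewrite !ltnS leq_eqVlt ltnS leq_eqVlt orbA (orbC (_ == k.+1)).
Qed.

(** Translation by [u] in S_d shows that the sum depends only on the orbit of [x]. *)
Lemma sum_permute_bits (R : realType) (d : nat) (phi : d.-tuple R -> R)
    (x : d.-tuple bool) :
  \sum_(s : 'S_d) phi (real_of_bits R (permute_tuple s x)) = symsum phi (bitsum x).
Proof.
have [u xE] := permute_first_ones x.
rewrite [RHS](reindex_inj (mulIg u)) /=; apply: eq_bigr => s _.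
by rewrite {1}xE permute_tupleM.
Qed.

(** Add up [#|'S_d|] copies of the left side, reindexing the copy of [s] by [permute_tuple s];
    invariance of [p] leaves the permutation on the argument of [phi] alone. *)
Lemma sum_symmetrize (R : realType) (d : nat) (phi : d.-tuple R -> R)
    (p : d.-tuple bool -> R) :
  (forall (s : 'S_d) x, p (permute_tuple s x) = p x) ->
  \sum_x p x * phi (real_of_bits R x)
    = (#|'S_d|%:R)^-1 * \sum_x p x * symsum phi (bitsum x).
Proof.
move=> p_sym.
have cardS_neq0 : #|'S_d|%:R != 0 :> R.
  by rewrite pnatr_eq0 -lt0n; apply/card_gt0P; exists 1%g.
apply: (mulfI cardS_neq0); rewrite mulVKf//.
transitivity (\sum_(s : 'S_d) \sum_x p x * phi (real_of_bits R x)).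
  by rewrite sumr_const mulr_natl; congr (_ *+ _); apply: eq_card.
under eq_bigr => s _ do rewrite (reindex_inj (@permute_tuple_inj _ _ s)).
rewrite exchange_big; apply: eq_bigr => x _.
by rewrite -sum_permute_bits mulr_sumr; apply: eq_bigr => s _; rewrite p_sym.
Qed.

(** * Convex sequences on {0,...,d} *)

Section discrete_convexity.
Context (R : realType) (d : nat) (G : nat -> R)
  (G_convex : forall k, (k.+2 <= d)%N -> G k.+1 - G k <= G k.+2 - G k.+1).

Lemma convex_slope_le (k l : nat) : (k <= l)%N -> (l < d)%N ->
  G k.+1 - G k <= G l.+1 - G l.
Proof.
elim: l => [|l IHl]; first by rewrite leqn0 => /eqP ->.
rewrite leq_eqVlt => /orP[/eqP -> //|kl ld].
exact: le_trans (IHl kl (ltnW ld)) (G_convex ld).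
Qed.

(** Moving right from [r], every increment of [G] is at least the one at [r]; moving left, at most.
    Each side is an induction on the distance to [r]. *)
Lemma convex_supporting_line (r k : nat) : (r < d)%N -> (k <= d)%N ->
  G r + (k%:R - r%:R) * (G r.+1 - G r) <= G k.
Proof.
move=> rd; have [rk|/ltnW kr] := leqP r k.
  move=> kd; rewrite -(subnKC rk); have : (r + (k - r) <= d)%N by rewrite subnKC.
  elim: (k - r)%N => [|n IHn]; first by rewrite addn0 subrr mul0r addr0.
  rewrite addnS => nd; have := IHn (ltnW nd).
  have := convex_slope_le (leq_addr n r) nd.
  by rewrite -natr1 natrD; set D := G r.+1 - G r; lra.
move=> _; rewrite -(subKn kr); have : (r - k <= r)%N by exact: leq_subr.
elim: (r - k)%N => [|n IHn]; first by rewrite subn0 subrr mul0r addr0.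
move=> nr; have := IHn (ltnW nr).
have := @convex_slope_le (r - n.+1) r (leq_subr _ _) rd.
(* The truncated subtractions are genuine because [n < r]; in particular [(r - n.+1).+1] is
   [r - n]. *)
rewrite -subSn// subSS !natrB// 1?ltnW// -natr1.
by set D := G r.+1 - G r; lra.
Qed.

(** For [k < d], evaluate the supporting line at [k] in 0 and in [d], with weights [d - k] and [k]:
    the slope terms cancel. The case [k = d] is separate, since that line uses [G k.+1]. *)
Lemma convex_chord (k : nat) : (k <= d)%N ->
  d%:R * G k <= (d%:R - k%:R) * G 0%N + k%:R * G d.
Proof.
rewrite leq_eqVlt => /orP[/eqP ->|kd]; first by rewrite subrr mul0r add0r.
have at0 := convex_supporting_line kd (leq0n d).
have atd := convex_supporting_line kd (leqnn d).
have d_k : 0 <= d%:R - k%:R :> R by rewrite subr_ge0 ler_nat ltnW.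
have := lerD (ler_wpM2l d_k at0) (ler_wpM2l (ler0n R k) atd).
by apply: le_trans; rewrite le_eqVlt; apply/orP; left; apply/eqP; ring.
Qed.

End discrete_convexity.

(** * Expectations as finite sums over {0,1}^d *)

Lemma measurable_tuple_set1 (R : realType) (d : nat) (x : d.-tuple R) :
  measurable [set x].
Proof.
have -> : [set x] = \big[setI/setT]_(j < d) ((@tnth d R)^~ j @^-1` [set tnth x j]).
  apply/seteqP; split => [_ ->|y]; rewrite -bigcap_seq /=.
    by move=> j _.
  by move=> yx; apply: eq_from_tnth => j; apply: yx; rewrite /= mem_index_enum.
apply: bigsetI_measurable => j _.
by rewrite -[X in measurable X]setTI; apply: measurable_tnth.
Qed.

Lemma real_of_bits_inj (R : realType) (d : nat) : injective (@real_of_bits R d).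
Proof.
move=> x y /(congr1 (fun u => tnth u _)) xy; apply: eq_from_tnth => j.
have /eqP := xy j; rewrite !tnth_mktuple eqr_nat.
by case: (tnth x j); case: (tnth y j).
Qed.

Section expectation_pmf.
Context (R : realType) (d : nat) (disp : measure_display)
  (T : measurableType disp) (P : probability T R) (V : {RV P >-> d.-tuple R}).

Lemma measurable_eq_tuple (x : d.-tuple R) : measurable [set t | V t = x].
Proof.
rewrite -[X in measurable X]setTI.
exact: (measurable_funPT V) _ (measurable_tuple_set1 x).
Qed.

(** Almost surely [phi \o V] equals a finite combination of indicators of the events [V = x], which
    is integrated termwise. *)
Lemma expectation_pmf (p : d.-tuple bool -> R) (phi : d.-tuple R -> R) :
  has_pmf V p -> {ae P, forall t, exists x, V t = real_of_bits R x} ->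
  measurable_fun [set: T] (phi \o V) ->
  ('E_P[phi \o V] = (\sum_x p x * phi (real_of_bits R x))%:E)%E.
Proof.
move=> Vp V_ae mphi.
pose A x := [set t | V t = real_of_bits R x].
have mA x : measurable (A x) by exact: measurable_eq_tuple.
have PA x : P (A x) = (p x)%:E by exact: Vp.
have iA x : P.-integrable [set: T] (fun t => (phi (real_of_bits R x))%:E * (\1_(A x) t)%:E)%E.
  by apply: integrableZl => //; apply: integrable_indic.
rewrite unlock /=.
rewrite (ae_eq_integral
  (fun t => \sum_x (phi (real_of_bits R x))%:E * (\1_(A x) t)%:E))%E//.
- rewrite integral_sum// -sumEFin; apply: eq_bigr => x _.
  rewrite integralZl//; last exact: integrable_indic.
  by rewrite integral_indic// setIT [X in (_ * X)%E]PA EFinM muleC.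
- exact/measurable_EFinP.
- by apply: (measurable_int P); apply: integrable_sum.
apply: filterS V_ae => t [x Vt] _ /=.
rewrite (bigD1 x)//= big1 ?adde0 => [|y yx].
  by rewrite indicE mem_set// mule1 Vt.
rewrite indicE memNset ?mule0//= /A /= Vt => /real_of_bits_inj xy.
by rewrite xy eqxx in yx.
Qed.

(** Serves the two extremal vectors, known only through their point masses: the events [V = x] are
    disjoint with total mass 1, so the complement of their union is null. *)
Lemma has_pmf_ae (p : d.-tuple bool -> R) :
  has_pmf V p -> \sum_x p x = 1 ->
  {ae P, forall t, exists x, V t = real_of_bits R x}.
Proof.
move=> Vp p1; pose A x := [set t | V t = real_of_bits R x].
have mA x : measurable (A x) by exact: measurable_eq_tuple.
have PA x : P (A x) = (p x)%:E by exact: Vp.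
have mU : measurable (\bigcup_(x in [set: d.-tuple bool]) A x).
  by apply: fin_bigcup_measurable => // ; exact: finite_finset.
exists (~` \bigcup_(x in [set: d.-tuple bool]) A x); split.
- exact: measurableC.
- rewrite probability_setC// measure_fin_bigcup//; last 2 first.
  + exact: finite_finset.
  + by move=> x y _ _ [t [/= Vx Vy]]; apply: (@real_of_bits_inj R); rewrite -Vx.
  rewrite (eq_fsbigr (fun x => (p x)%:E)); last by move=> x _; exact: PA.
  have -> : [set: d.-tuple bool] = [set` index_enum (d.-tuple bool)].
    by apply/seteqP; split => x _ //=; rewrite mem_index_enum.
  by rewrite -fsbig_seq ?index_enum_uniq// sumEFin p1 subee.
- by apply: subsetC => t [x _ Vt]; exists x.
Qed.

Lemma expectation_symsum (p : d.-tuple bool -> R) (phi : d.-tuple R -> R) :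
  has_pmf V p -> {ae P, forall t, exists x, V t = real_of_bits R x} ->
  (forall (s : 'S_d) x, p (permute_tuple s x) = p x) ->
  P.-integrable [set: T] (EFin \o (phi \o V)) ->
  ('E_P[phi \o V] =
   ((#|'S_d|%:R)^-1 * \sum_x p x * symsum phi (bitsum x))%:E)%E.
Proof.
move=> Vp V_ae p_sym iphi; rewrite -sum_symmetrize//; apply: expectation_pmf => //.
exact/measurable_EFinP/(measurable_int P).
Qed.

Lemma has_pmf_fine : has_pmf V (fun x => fine (P [set t | V t = real_of_bits R x])).
Proof.
move=> x; rewrite fineK// fin_num_measure//; exact: measurable_eq_tuple.
Qed.

(** Exchangeability is applied to the singleton of the permuted point; permuting coordinates is
    injective, so the permuted vector hits it exactly when [V] hits [x]. *)
Lemma exchangeable_pmf (p : d.-tuple bool -> R) (s : 'S_d) (x : d.-tuple bool) :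
  exchangeable V -> has_pmf V p -> p (permute_tuple s x) = p x.
Proof.
move=> V_exch Vp; apply: EFin_inj; rewrite -!Vp.
have mB : measurable [set real_of_bits R (permute_tuple s x)].
  exact: measurable_tuple_set1.
have := V_exch s _ mB; rewrite /distribution /pushforward /preimage /= => <-.
congr (P _); apply/seteqP; split => t /= Vt; last first.
  by rewrite Vt; apply: eq_from_tnth => j; rewrite !tnth_mktuple.
apply: (@permute_tuple_inj _ _ s); rewrite /permute_tuple Vt.
by apply: eq_from_tnth => j; rewrite !tnth_mktuple.
Qed.

Lemma symmetric_bernoulli_ae : symmetric_bernoulli V ->
  {ae P, forall t, exists x, V t = real_of_bits R x}.
Proof.
move=> [V01 _]; apply: filterS V01 => t V01.
exists [tuple tnth (V t) j == 1 | j < d].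
apply: eq_from_tnth => j; rewrite !tnth_mktuple.
by have [->|->] := V01 j; rewrite ?eqxx// eq_sym oner_eq0.
Qed.

Lemma sum_pmf1 (p : d.-tuple bool -> R) : has_pmf V p ->
  {ae P, forall t, exists x, V t = real_of_bits R x} -> \sum_x p x = 1.
Proof.
move=> Vp V_ae; apply: EFin_inj.
have := expectation_pmf Vp V_ae (phi := cst 1) (measurable_cst _).
rewrite [X in ('E_P[X])%E](_ : _ = cst 1)// expectation_cst => ->.
by congr EFin; apply: eq_bigr => x _; rewrite /= mulr1.
Qed.

Lemma sum_pmf_bitsum (p : d.-tuple bool -> R) :
  symmetric_bernoulli V -> has_pmf V p -> \sum_x p x * (bitsum x)%:R = d%:R / 2.
Proof.
move=> V_bern Vp; have V_ae := symmetric_bernoulli_ae V_bern.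
under eq_bigr do rewrite natr_sum mulr_sumr.
have -> : d%:R / 2 = \sum_(j < d) (1 / 2) :> R.
  by rewrite sumr_const card_ord -[RHS]mulr_natl mul1r.
rewrite exchange_big /=.
apply: eq_bigr => j _; apply: EFin_inj.
(* After exchanging sums, the [j]-th term is the expectation of this indicator, that is, the
   marginal probability 1/2. *)
pose phi (v : d.-tuple R) : R := (tnth v j == 1)%:R.
pose A := [set t | tnth (V t) j = 1].
have mA : measurable A.
  have mVj : measurable_fun [set: T] (fun t => tnth (V t) j).
    exact: (measurableT_comp (measurable_tnth j)).
  by rewrite -[A]setTI; exact: mVj measurableT _ (measurable_set1 1).
have phiV : phi \o V = \1_A.
  apply/funext => t; rewrite indicE /phi /=.
  by case: eqP => Vj; [rewrite mem_set|rewrite memNset].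
have := expectation_pmf Vp V_ae (phi := phi).
rewrite phiV expectation_indic// (V_bern.2 j) mul1r => ->; last exact: measurable_indic.
congr EFin; apply: eq_bigr => x _; rewrite /phi tnth_mktuple.
by case: (tnth x j); rewrite ?eqxx// eq_sym oner_eq0.
Qed.

End expectation_pmf.

(** * Level sums of the extremal laws and the comparison *)

Lemma sum_pmf_minus (R : realType) (d r : nat) (f : nat -> R) : (r < d)%N ->
  \sum_x @pmf_minus R d r x * f (bitsum x)
    = (r%:R + 1 - d%:R / 2) * f r + (d%:R / 2 - r%:R) * f r.+1.
Proof.
move=> rd; have C_neq0 k : (k <= d)%N -> 'C(d, k)%:R != 0 :> R.
  by move=> kd; rewrite pnatr_eq0 -lt0n bin_gt0.
pose a := (r%:R + 1 - d%:R / 2) / 'C(d, r)%:R : R.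
pose b := (d%:R / 2 - r%:R) / 'C(d, r.+1)%:R : R.
transitivity (\sum_(x : d.-tuple bool | bitsum x == r) a * f (bitsum x) +
  \sum_(x : d.-tuple bool | bitsum x == r.+1) b * f (bitsum x)).
  rewrite [X in X + _]big_mkcond [X in _ + X]big_mkcond -big_split; apply: eq_bigr => x _ /=.
  rewrite /pmf_minus; case: eqP => [->|_]; first by rewrite ltn_eqF// addr0.
  by case: eqP => _; rewrite add0r// mul0r.
(* The size of each level cancels the binomial normalizing [pmf_minus]; both binomials are nonzero
   because [r < d]. *)
rewrite (sum_bitsum_eq d r (fun k => a * f k)).
rewrite (sum_bitsum_eq d r.+1 (fun k => b * f k)) /a /b -!(mulr_natr (_ * _)).
by field; rewrite !C_neq0// ltnW.
Qed.

Lemma sum_pmf_plus (R : realType) (d : nat) (f : nat -> R) : (0 < d)%N ->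
  \sum_x @pmf_plus R d x * f (bitsum x) = 1 / 2 * f 0%N + 1 / 2 * f d.
Proof.
move=> d_gt0.
transitivity (\sum_(x : d.-tuple bool | bitsum x == 0%N) 1 / 2 * f (bitsum x) +
  \sum_(x : d.-tuple bool | bitsum x == d) 1 / 2 * f (bitsum x)).
  rewrite [X in X + _]big_mkcond [X in _ + X]big_mkcond -big_split; apply: eq_bigr => x _ /=.
  (* The levels 0 and [d] are distinct because [0 < d], so neither mass is counted twice. *)
  rewrite /pmf_plus; case: eqP => [->|_]; first by rewrite ltn_eqF// addr0.
  by case: eqP => _; rewrite add0r// mul0r.
by rewrite !(sum_bitsum_eq d _ (fun k => 1 / 2 * f k)) bin0 binn !mulr1n.
Qed.

Theorem theorem5p5 (R : realType) (d r : nat) (d_ge2 : (2 <= d)%N)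
    (r_le : r%:R <= d%:R / 2 :> R) (r_ge : d%:R / 2 <= r%:R + 1 :> R)
    (dispm : measure_display) (Tm : measurableType dispm)
    (Pm : probability Tm R) (Im : {RV Pm >-> d.-tuple R})
    (Im_pmf : has_pmf Im (@pmf_minus R d r))
    (dispp : measure_display) (Tp : measurableType dispp)
    (Pp : probability Tp R) (Ip : {RV Pp >-> d.-tuple R})
    (Ip_pmf : has_pmf Ip (@pmf_plus R d))
    (disp : measure_display) (T : measurableType disp)
    (P : probability T R) (I : {RV P >-> d.-tuple R})
    (I_bernoulli : symmetric_bernoulli I) (I_exch : exchangeable I) :
  sm_le Im I /\ sm_le I Ip.

Proof.
have rd : (r < d)%N.
  rewrite -(ltr_nat R); apply: le_lt_trans r_le _.
  have : 2 <= d%:R :> R by rewrite ler_nat.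
  lra.
have d_gt0 : (0 < d)%N by exact: leq_trans d_ge2.
have I_ae := symmetric_bernoulli_ae I_bernoulli.
have I_pmf := has_pmf_fine I; set p := (fun x => _) in I_pmf.
have p_ge0 x : 0 <= p x by rewrite fine_ge0.
have p_sym s x : p (permute_tuple s x) = p x by exact: exchangeable_pmf I_pmf.
have p1 := sum_pmf1 I_pmf I_ae.
have p_mean := sum_pmf_bitsum I_bernoulli I_pmf.
have Im_ae : {ae Pm, forall t, exists x, Im t = real_of_bits R x}.
  (* The factor 1 lets the level sum with [f] constant compute the total mass. *)
  apply: (has_pmf_ae Im_pmf); under eq_bigr do rewrite -[pmf_minus _ _ _]mulr1.
  by rewrite (sum_pmf_minus (fun=> 1))//; lra.
have Ip_ae : {ae Pp, forall t, exists x, Ip t = real_of_bits R x}.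
  apply: (has_pmf_ae Ip_pmf); under eq_bigr do rewrite -[pmf_plus _ _]mulr1.
  by rewrite (sum_pmf_plus (fun=> 1))//; lra.
split=> phi phi_sm iV iV'.
- rewrite (expectation_symsum Im_pmf)//; last first.
    by move=> s x; rewrite /pmf_minus bitsum_permute.
  rewrite (expectation_symsum I_pmf)// lee_fin ler_wpM2l ?invr_ge0//.
  rewrite sum_pmf_minus//; set G := symsum phi.
  (* The left side is the line through [r] and [r.+1] evaluated at [d / 2]. As [p] has mass 1 and
     mean level [d / 2], it is the [p]-average of that line, which is compared with [G]
     pointwise. *)
  have -> : (r%:R + 1 - d%:R / 2) * G r + (d%:R / 2 - r%:R) * G r.+1 =
      \sum_x p x * (G r + ((bitsum x)%:R - r%:R) * (G r.+1 - G r)).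
    transitivity (\sum_x (p x * (G r - r%:R * (G r.+1 - G r)) +
        p x * (bitsum x)%:R * (G r.+1 - G r))).
      by rewrite big_split -!mulr_suml p1 p_mean /=; lra.
    by apply: eq_bigr => x _; lra.
  apply: ler_sum => x _; apply: ler_wpM2l => //.
  apply: (@convex_supporting_line _ d) => //; last exact: bitsum_le.
  by move=> k kd; exact: symsum_convex.
- rewrite (expectation_symsum Ip_pmf)//; last first.
    by move=> s x; rewrite /pmf_plus bitsum_permute.
  rewrite (expectation_symsum I_pmf)// lee_fin ler_wpM2l ?invr_ge0//.
  have dR_gt0 : 0 < d%:R :> R by rewrite ltr0n.
  rewrite sum_pmf_plus//; set G := symsum phi.
  (* Likewise the left side is the chord at [d / 2], hence its [p]-average. *)
  have -> : 1 / 2 * G 0%N + 1 / 2 * G d =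
      \sum_x p x * (((d%:R - (bitsum x)%:R) * G 0%N + (bitsum x)%:R * G d) / d%:R).
    transitivity (\sum_x (p x * G 0%N +
        p x * (bitsum x)%:R * ((G d - G 0%N) / d%:R))).
      by rewrite big_split -!mulr_suml p1 p_mean /=; field; rewrite gt_eqF.
    by apply: eq_bigr => x _; field; rewrite gt_eqF.
  apply: ler_sum => x _; apply: ler_wpM2l => //.
  rewrite ler_pdivlMr// mulrC.
  apply: convex_chord; last exact: bitsum_le.
  by move=> k kd; exact: symsum_convex.
Qed.
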